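(* For all natural numbers $m,n$, $$\gamma(Q_{m\times n})\ \ge\ \beta(Q_{m\times n})\ \ge\ \begin{cases}\min\{m,n\} & \text{if } \max\{m,n\}\ge 3\min\{m,n\}-2,\\ (m+n-2)/4+1 & \text{else if } m,n \text{ are both even and } m+n\equiv 6 \pmod 8,\\ (m+n-2)/4+1 & \text{else if } m,n \text{ are both odd and } m+n\equiv 2 \pmod 8,\\ (m+n-2)/4 & \text{otherwise,}\end{cases}$$ where the cases are evaluated in order (each case applies only if none of the preceding ones does).
   Context: Natural numbers are positive integers. The squares (cells) of the $m\times n$ chessboard are $V(Q_{m\times n})=\{(x,y): 0\le x\le m-1,\ 0\le y\le n-1\}$, with $x$ the column number and $y$ the row number. A column is a set of all cells with a fixed $x$; a row is a set of all cells with a fixed $y$; a sum diagonal is a (nonempty) set of all cells with a fixed value of $x+y$; a difference diagonal is a (nonempty) set of all cells with a fixed value of $x-y$. The Queen's graph $Q_{m\times n}$ has vertex set $V(Q_{m\times n})$, two distinct cells being adjacent if they lie in a common row, column, sum diagonal or difference diagonal. $\gamma(Q_{m\times n})$ is the minimum size of a dominating set of $Q_{m\times n}$, i.e. of a set $\mathcal D$ of cells such that every cell is in $\mathcal D$ or adjacent to an element of $\mathcal D$. $\beta(Q_{m\times n})$ (Relaxed Queen's Domination) is the least number $p$ such that there exist rows $R_0,\dots,R_{p-1}$, columns $C_0,\dots,C_{p-1}$, sum diagonals $S_0,\dots,S_{p-1}$ and difference diagonals $D_0,\dots,D_{p-1}$ (repetitions allowed) with $V(Q_{m\times n})=\bigcup_i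 R_i\cup\bigcup_i C_i\cup\bigcup_i S_i\cup\bigcup_i D_i$. *)

(* Defs.v *)
From mathcomp Require Import all_boot all_order all_algebra.
Set Implicit Arguments.
Unset Strict Implicit.
Unset Printing Implicit Defensive.

(* [c.1] is the column number x and [c.2] the row number y. *)
Notation cell m n := ('I_m * 'I_n)%type.

Definition columns (m n : nat) : {set {set cell m n}} :=
  [set [set c : cell m n | c.1 == x] | x : 'I_m].

Definition rows (m n : nat) : {set {set cell m n}} :=
  [set [set c : cell m n | c.2 == y] | y : 'I_n].

(* Diagonals are indexed by one of their cells, which makes them nonempty. *)
Definition sum_diagonals (m n : nat) : {set {set cell m n}} :=
  [set [set c : cell m n | c.1 + c.2 == a.1 + a.2] | a : cell m n].

(* The difference is taken in [int], not truncated in [nat]. *)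
Definition diff_diagonals (m n : nat) : {set {set cell m n}} :=
  [set [set c : cell m n | (c.1%:Z - c.2%:Z == a.1%:Z - a.2%:Z)%R]
    | a : cell m n].

Definition lines (m n : nat) : {set {set cell m n}} :=
  rows m n :|: columns m n :|: sum_diagonals m n :|: diff_diagonals m n.

Definition queen_adj (m n : nat) : rel (cell m n) :=
  fun c d => (c != d) && [exists L in lines m n, (c \in L) && (d \in L)].

Definition dominating (m n : nat) (D : {set cell m n}) : bool :=
  [forall c, (c \in D) || [exists d in D, queen_adj c d]].

Lemma dominating_setT (m n : nat) : dominating [set: cell m n].
Proof. by apply/forallP => c; rewrite inE. Qed.

Lemma ex_dominating (m n : nat) :
  exists k, [exists D : {set cell m n}, dominating D && (#|D| == k)].
Proof.
exists #|[set: cell m n]|; apply/existsP; exists setT.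
by rewrite dominating_setT eqxx.
Qed.

Definition queen_gamma (m n : nat) : nat := ex_minn (ex_dominating m n).

Definition relaxed_cover (m n p : nat) : bool :=
  [exists R : {ffun 'I_p -> {set cell m n}},
   exists C : {ffun 'I_p -> {set cell m n}},
   exists S : {ffun 'I_p -> {set cell m n}},
   exists D : {ffun 'I_p -> {set cell m n}},
    [&& [forall i, R i \in rows m n],
        [forall i, C i \in columns m n],
        [forall i, S i \in sum_diagonals m n],
        [forall i, D i \in diff_diagonals m n]
      & [set: cell m n] ==
          (\bigcup_i R i) :|: (\bigcup_i C i) :|:
          (\bigcup_i S i) :|: (\bigcup_i D i)]].

Lemma ex_relaxed_cover (m n : nat) : exists p, relaxed_cover m n p.
Proof.
exists #|{: cell m n}|.
pose e (i : 'I_#|{: cell m n}|) : cell m n := enum_val i.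
apply/existsP; exists [ffun i => [set c : cell m n | c.2 == (e i).2]].
apply/existsP; exists [ffun i => [set c : cell m n | c.1 == (e i).1]].
apply/existsP; exists [ffun i =>
  [set c : cell m n | c.1 + c.2 == (e i).1 + (e i).2]].
apply/existsP; exists [ffun i =>
  [set c : cell m n | (c.1%:Z - c.2%:Z ==
     (e i).1%:Z - (e i).2%:Z)%R]].
apply/and5P; split; try by apply/forallP => i; rewrite ffunE imset_f.
rewrite eq_sym eqEsubset subsetT; apply/subsetP => c _; rewrite !inE.
suff -> : c \in \bigcup_i [ffun i =>
  [set c : cell m n | c.2 == (e i).2]] i by [].
by apply/bigcupP; exists (enum_rank c); rewrite // ffunE inE /e enum_rankK.
Qed.

Definition queen_beta (m n : nat) : nat := ex_minn (ex_relaxed_cover m n).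

(* Main.v *)
Require Import Defs.
From mathcomp Require Import all_boot all_order all_algebra.
From mathcomp Require Import zify lra.

(** The lines through the queens of a dominating set form a relaxed cover, so
    gamma >= beta.

    For the lower bound on beta, let p rows, p columns, p sum diagonals and p
    difference diagonals cover the board.  If p >= min(m, n), every case of the
    bound holds by arithmetic.  Otherwise some columns and some rows are free of
    chosen lines; let A and B be the sets of these, translated so that the
    extreme ones are 0 and a, respectively 0 and b.  The cells of A x B on the
    border of the box [0, a] x [0, b] are covered by diagonals only.  The
    diagonal x + y = s meets the left side only if s <= b, the right side only
    if s >= a, the bottom only if s <= a and the top only if s >= b, so it
    accounts for at most two incidences of covered border cells with sides, plus
    one if s = a and one if s = b.
    The difference diagonals obey the same rules once they are indexed by
    d = x + (b - y), which amounts to a reflection.  The four sides carry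
    2 |A| + 2 |B| incidences, whence |A| + |B| <= 2 p + 2, and therefore
    m + n <= 4 p + 2.

    In the case of equality every side is matched bijectively with the diagonals
    that meet it.  Then the sum of the coordinates along a side can also be
    computed from the diagonals.  Comparing left with right and bottom with top,
    in cardinality and in sum of coordinates, forces as many sum diagonals as
    difference diagonals to meet the left side; hence |B| = n - p is even
    ([box_cover_bound], [relaxed_cover_bound]).  This parity excludes equality
    in the two congruence cases.  It also settles the first case: there
    p < min(m, n) would force equality with p = min(m, n) - 1, so that n - p or
    m - p is 1, while both have the same parity. *)

Set Implicit Arguments.
Unset Strict Implicit.
Unset Printing Implicit Defensive.

(** * Sides of a box and the diagonals that meet them *)

(** A diagonal is given by its index, and a side of the box by the condition
    [P] for a diagonal to meet it; [f] sends such a diagonal to the coordinate,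
    along the side, of the common cell. *)
Definition hits (P : pred nat) (f : nat -> nat) (S : seq nat) : seq nat :=
  map f (filter P S).

Lemma size_hits (P : pred nat) (f : nat -> nat) (S : seq nat) :
  size (hits P f S) = count P S.
Proof. by rewrite size_map size_filter. Qed.

(** [X] lists the coordinates of the cells of one side that have to be covered,
    and [u x], [v x] are the indices of the two diagonals through the cell [x].
    When there are no more incidences than cells, each cell is covered exactly
    once, which is why the coordinates sum to the same value. *)
Lemma side_cover (X S D : seq nat) (P Q : pred nat) (f g u v : nat -> nat) :
    uniq X ->
    (forall x : nat, x \in X -> (u x \in S) || (v x \in D)) ->
    (forall x : nat, x \in X ->
       [/\ P (u x), f (u x) = x, Q (v x) & g (v x) = x]) ->
  size X <= count P S + count Q D /\
  (count P S + count Q D <= size X ->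
     X =i hits P f S ++ hits Q g D /\
     sumn X = sumn (hits P f S) + sumn (hits Q g D)).
Proof.
move=> uX cov uv; rewrite -sumn_cat.
have sX : {subset X <= hits P f S ++ hits Q g D}.
  move=> x Xx; have [Pu fu Qv gv] := uv x Xx; rewrite mem_cat.
  case/orP: (cov x Xx) => [Su|Dv]; apply/orP; [left|right]; apply/mapP.
    by exists (u x); rewrite ?mem_filter ?Pu.
  by exists (v x); rewrite ?mem_filter ?Qv.
have -> : count P S + count Q D = size (hits P f S ++ hits Q g D).
  by rewrite size_cat !size_hits.
split=> [|le_sz]; first exact: uniq_leq_size.
have uL := leq_size_uniq uX sX le_sz.
have [_ eX] := uniq_min_size uX sX le_sz.
by split=> //; apply: perm_sumn; apply: uniq_perm.
Qed.

(** Opposite inequalities overlap at [k]; this is the surplus incidence of the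
    diagonal through the corner. *)
Lemma count_leq_geq (k : nat) (S : seq nat) : uniq S ->
  count (leq^~ k) S + count (leq k) S = size S + (k \in S).
Proof.
move=> uS; rewrite -(count_uniq_mem k uS); elim: S {uS} => //= s S.
by case: (ltngtP s k) => /=; lia.
Qed.

(** In bottom - top - left + right each sum diagonal [s] contributes
    [(b - a) + a * (s <= a) - b * (s <= b)].  Its index cancels: corners aside,
    [s] meets one of the left and top sides and one of the bottom and right
    sides, and the coordinate of each common cell is [s] minus a constant.  The
    terms are distributed so that no difference of sums occurs. *)
Lemma sum_sides (a b : nat) (S : seq nat) :
  sumn (hits (leq^~ a) id S) + sumn (hits (leq a) (subn^~ a) S)
    + size S * a + b * count (leq^~ b) S =
  sumn (hits (leq b) (subn^~ b) S) + sumn (hits (leq^~ b) id S)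
    + size S * b + a * count (leq^~ a) S.
Proof.
rewrite /hits; elim: S => [|s S IH] /=; first lia.
by case: (leqP s a); case: (leqP a s); case: (leqP s b); case: (leqP b s) => /=;
  lia.
Qed.

(** The same combination bottom - top - left + right on difference diagonals,
    each of which contributes [(a - b) - a * (d <= a) + b * (a <= d)].  The
    constant terms are opposite to those of the sum diagonals, so they cancel
    when there are equally many diagonals of both kinds. *)
Lemma diff_sides (a b : nat) (D : seq nat) : all (leq^~ (a + b)) D ->
  sumn (hits (leq b) (subn^~ b) D) + sumn (hits (leq a) (subn (a + b)) D)
    + size D * b + a * count (leq^~ a) D =
  sumn (hits (leq^~ a) id D) + sumn (hits (leq^~ b) (subn b) D)
    + size D * a + b * count (leq a) D.
Proof.
rewrite /hits; elim: D => [|d D IH] /=; first lia.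
case/andP=> dab /IH {}IH.
by case: (leqP d a); case: (leqP a d); case: (leqP d b); case: (leqP b d) => /=;
  lia.
Qed.

(** The border count and its case of equality.  Let [delta] be the number of
    difference diagonals minus the number of sum diagonals that meet the left
    side.  The counts on the four sides and the weighted identity of [sum_sides]
    and [diff_sides] together give [(a + b) * delta = 0]. *)
Lemma box_cover_bound (a b p : nat) (A B S D : seq nat) :
    uniq A -> uniq B -> uniq S -> uniq D -> size S <= p -> size D <= p ->
    0 \in A -> a \in A -> all (leq^~ a) A ->
    0 \in B -> b \in B -> all (leq^~ b) B ->
    (forall x y : nat, x \in A -> y \in B ->
       (x + y \in S) || (x + (b - y) \in D)) ->
  size A + size B <= p.*2.+2 /\
  (size A + size B = p.*2.+2 -> ~~ odd (size B)).
Proof.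
move=> uA uB uS uD leSp leDp A0 Aa /allP leA B0 Bb /allP leB cov.
(* The suffixes L, R, F, T stand for left, right, foot and top. *)
have [|leL eqL] := side_cover (P := leq^~ b) (f := id) (Q := leq^~ b)
    (g := subn b) uB (fun y => cov _ y A0).
  by move=> y /leB /=; clear; split; lia.
have [|leR eqR] := side_cover (P := leq a) (f := subn^~ a) (Q := leq a)
    (g := subn (a + b)) uB (fun y => cov _ y Aa).
  by move=> y /leB /=; clear; split; lia.
have [|leF eqF] := side_cover (P := leq^~ a) (f := id) (Q := leq b)
    (g := subn^~ b) uA (fun x Ax => cov x _ Ax B0).
  by move=> x /leA /=; clear; split; lia.
have [|leT eqT] := side_cover (P := leq b) (f := subn^~ b) (Q := leq^~ a)
    (g := id) uA (fun x Ax => cov x _ Ax Bb).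
  by move=> x /leA /=; clear; split; lia.
have Sa := count_leq_geq a uS; have Sb := count_leq_geq b uS.
have Da := count_leq_geq a uD; have Db := count_leq_geq b uD.
have a_S := leq_b1 (a \in S); have b_S := leq_b1 (b \in S).
have a_D := leq_b1 (a \in D); have b_D := leq_b1 (b \in D).
have bound : size A + size B <= p.*2.+2.
  move: leSp leDp leL leR leF leT Sa Sb Da Db a_S b_S a_D b_D; clear; lia.
split=> // tight.
have [[eSp eDp] [cL cR cF cT]] : (size S = p /\ size D = p) /\
    [/\ size B = count (leq^~ b) S + count (leq^~ b) D,
    size B = count (leq a) S + count (leq a) D,
    size A = count (leq^~ a) S + count (leq b) D &
    size A = count (leq b) S + count (leq^~ a) D].
  move: tight leSp leDp leL leR leF leT Sa Sb Da Db a_S b_S a_D b_D; clear.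
  by move=> *; split; split; lia.
have [_ {}eqL] := eqL (eq_leq (esym cL)).
have [_ {}eqR] := eqR (eq_leq (esym cR)).
have [memF {}eqF] := eqF (eq_leq (esym cF)).
have [_ {}eqT] := eqT (eq_leq (esym cT)).
(* A diagonal beyond the far corner would hit the foot outside [0, a]. *)
have leD : all (leq^~ (a + b)) D.
  apply/allP => d Dd /=; rewrite leqNgt; apply/negP => ltd.
  have leb : b <= d by move: ltd; clear; lia.
  have /leA /= : d - b \in A.
    rewrite memF mem_cat; apply/orP; right; apply/mapP.
    by exists d; rewrite // mem_filter leb.
  by move: ltd; clear; lia.
have eqS := sum_sides a b S; have eqD := diff_sides leD.
have weighted : a * count (leq^~ a) S + b * count (leq a) D =
  a * count (leq^~ a) D + b * count (leq^~ b) S.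
  move: eqS eqD eqL eqR eqF eqT; rewrite eSp eDp; clear; lia.
suff eSD : count (leq^~ b) S = count (leq^~ b) D.
  by rewrite cL eSD addnn odd_double.
(* In a square box the counts alone suffice; this covers a = b = 0, where the
   weighted identity is void. *)
have [eab|neab] := eqVneq a b.
  move: tight eSp eDp cL cR cF cT Sa Sb Da Db a_S b_S a_D b_D.
  rewrite eab; clear; lia.
(* Both equations express delta: on a and on b in the first, through a <= d
   in the second. *)
have delta : count (leq^~ a) S + count (leq^~ b) S
    = count (leq^~ a) D + count (leq^~ b) D /\
    count (leq a) D + count (leq^~ a) D = count (leq^~ b) S + count (leq^~ a) S.
  move: tight eSp eDp cL cR cF cT Sa Sb Da Db a_S b_S a_D b_D.
  by clear; move=> *; split; lia.
move: neab weighted delta; clear; nia.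
Qed.

(** * From the chessboard to the box *)

(** [L] is the list of the used columns (or rows), and [A] that of the free
    ones, translated by the first of them. *)
Lemma avoiding_box (m : nat) (L : seq nat) : size L < m ->
  exists (x0 a : nat) (A : seq nat),
    [/\ uniq A, [&& 0 \in A, a \in A & all (leq^~ a) A],
        m <= size A + size L &
        forall x : nat, x \in A -> x0 + x < m /\ x0 + x \notin L].
Proof.
move=> ltLm; pose U := [seq x <- iota 0 m | x \notin L].
have leU : m <= size U + size L.
  have := count_predC (mem L) (iota 0 m); rewrite size_iota => <-.
  rewrite addnC /U size_filter leq_add2l.
  rewrite -size_filter uniq_leq_size ?filter_uniq ?iota_uniq // => x.
  by rewrite mem_filter => /andP[].
have exU : exists x, x \in U.
  have : 0 < size U by lia.
  by case: U {leU} => // x U _; exists x; rewrite mem_head.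
have ubU x : x \in U -> x <= m.
  by rewrite mem_filter mem_iota => /and3P[_ _ /ltnW].
case: (ex_minnP exU) => x0 Ux0 min_x0.
case: (ex_maxnP exU ubU) => x1 Ux1 max_x1.
exists x0, (x1 - x0), [seq x - x0 | x <- U]; split.
- rewrite map_inj_in_uniq ?filter_uniq ?iota_uniq // => x y /min_x0 lex /min_x0.
  by move: lex; clear; lia.
- apply/and3P; split; try by apply: map_f.
    by apply/mapP; exists x0; rewrite ?subnn.
  by apply/allP => _ /mapP[x /max_x1 lex ->]; apply: leq_sub2r.
- by rewrite size_map.
- move=> _ /mapP[x Ux ->]; rewrite subnKC ?min_x0 //.
  by move: Ux; rewrite mem_filter mem_iota => /and3P[].
Qed.

(** The index [k - l] of a difference diagonal, transported to the box; no
    truncation occurs, since the left-hand side is nonnegative. *)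
Lemma shift_difference (x0 x y0 y b k l : nat) :
    ((x0 + x)%:Z - (y0 + y)%:Z = k%:Z - l%:Z)%R -> y <= b ->
  x + (b - y) = k + (y0 + b) - l - x0.
Proof. lia. Qed.

(** At most [p] columns and [p] rows are used, so [|A| >= m - p] and
    [|B| >= n - p], with equality when [m + n = 4 p + 2]. *)
Lemma relaxed_cover_bound (m n p : nat) :
    relaxed_cover m n p -> p < m -> p < n ->
  m + n <= (p.*2.+1).*2 /\ (m + n = (p.*2.+1).*2 -> ~~ odd (n - p)).
Proof.
case/existsP=> R /existsP[C /existsP[S /existsP[D /and5P[]]]].
move=> /forallP Rr /forallP Cc /forallP Ss /forallP Dd /eqP cov ltpm ltpn.
have exR i : exists y : 'I_n, R i = [set z | z.2 == y].
  by have /imsetP[y _ ->] := Rr i; exists y.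
have exC i : exists x : 'I_m, C i = [set z | z.1 == x].
  by have /imsetP[x _ ->] := Cc i; exists x.
have exS i : exists e : cell m n,
    S i = [set z : cell m n | z.1 + z.2 == e.1 + e.2].
  by have /imsetP[e _ ->] := Ss i; exists e.
have exD i : exists e : cell m n,
    D i = [set z : cell m n | (z.1%:Z - z.2%:Z == e.1%:Z - e.2%:Z)%R].
  by have /imsetP[e _ ->] := Dd i; exists e.
have [[r Er] [c Ec]] := (fin_all_exists exR, fin_all_exists exC).
have [[s Es] [d Ed]] := (fin_all_exists exS, fin_all_exists exD).
have sz (f : 'I_p -> nat) : size (codom f) = p by rewrite size_codom card_ord.
have [|x0 [a [A [uA /and3P[A0 Aa leA] szA memA]]]] :=
  @avoiding_box m (codom (fun i => val (c i))); first by rewrite sz.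
have [|y0 [b [B [uB /and3P[B0 Bb leB] szB memB]]]] :=
  @avoiding_box n (codom (fun i => val (r i))); first by rewrite sz.
rewrite sz in szA; rewrite sz in szB.
pose S' := codom (fun i => (s i).1 + (s i).2 - (x0 + y0)).
pose D' := codom (fun i => (d i).1 + (y0 + b) - (d i).2 - x0).
have [] := @box_cover_bound a b p A B (undup S') (undup D') uA uB
  (undup_uniq _) (undup_uniq _) _ _ A0 Aa leA B0 Bb leB _.
- by rewrite (leq_trans (size_undup _)) // sz.
- by rewrite (leq_trans (size_undup _)) // sz.
- move=> x y Ax By; have [ltx Cx] := memA x Ax; have [lty Ry] := memB y By.
  have := in_setT (Ordinal ltx, Ordinal lty); rewrite cov !inE !mem_undup.
  have leyb := allP leB _ By.
  case/orP=> [/orP[/orP[]|]|] /bigcupP[i _].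
  + rewrite Er inE => /eqP/(congr1 val)/= Ey.
    by case/negP: Ry; rewrite Ey; apply/codomP; exists i.
  + rewrite Ec inE => /eqP/(congr1 val)/= Ex.
    by case/negP: Cx; rewrite Ex; apply/codomP; exists i.
  + rewrite Es inE /= => /eqP Exy; apply/orP; left; apply/codomP; exists i.
    by move: Exy; clear; lia.
  + rewrite Ed inE => /eqP Exy; apply/orP; right; apply/codomP; exists i.
    exact: shift_difference Exy leyb.
move=> bound tight; split; first by move: bound szA szB; clear; lia.
move=> Emn.
have [tAB EB] : size A + size B = p.*2.+2 /\ size B = n - p.
  by move: bound szA szB Emn ltpm ltpn; clear; split; lia.
by rewrite -EB tight.
Qed.

(** * Domination and the lower bound *)

Lemma dominating_relaxed_cover (m n : nat) (D : {set cell m n}) :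
  dominating D -> relaxed_cover m n #|D|.
Proof.
move=> /forallP dom; pose e (i : 'I_#|D|) : cell m n := enum_val i.
apply/existsP; exists [ffun i => [set c : cell m n | c.2 == (e i).2]].
apply/existsP; exists [ffun i => [set c : cell m n | c.1 == (e i).1]].
apply/existsP; exists [ffun i =>
  [set c : cell m n | c.1 + c.2 == (e i).1 + (e i).2]].
apply/existsP; exists [ffun i =>
  [set c : cell m n | (c.1%:Z - c.2%:Z == (e i).1%:Z - (e i).2%:Z)%R]].
apply/and5P; split; try by apply/forallP => i; rewrite ffunE imset_f.
rewrite eq_sym eqEsubset subsetT; apply/subsetP => c _; rewrite !inE.
have [d Dd share] : exists2 d, d \in D & [|| c.2 == d.2, c.1 == d.1,
    c.1 + c.2 == d.1 + d.2 | (c.1%:Z - c.2%:Z == d.1%:Z - d.2%:Z)%R].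
  case/orP: (dom c) => [Dc|]; first by exists c; rewrite ?eqxx.
  case/existsP=> d /and3P[Dd _ /existsP[L /and3P[]]].
  rewrite !inE => lineL cL dL; exists d => //.
  case/orP: lineL cL dL => [/orP[/orP[]|]|] /imsetP[z _ ->];
    by rewrite !inE => /eqP-> /eqP->; rewrite eqxx ?orbT.
have ed : e (enum_rank_in Dd d) = d by rewrite /e enum_rankK_in.
by case/or4P: share => share; [do 3 (apply/orP; left)
  | do 2 (apply/orP; left); apply/orP; right
  | apply/orP; left; apply/orP; right | apply/orP; right];
  apply/bigcupP; exists (enum_rank_in Dd d); rewrite // ffunE inE ed.
Qed.

Theorem theorem4p4 (m n : nat) (m_gt0 : 0 < m) (n_gt0 : 0 < n) :
  queen_beta m n <= queen_gamma m n /\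
  ((if (3 * minn m n - 2 <= maxn m n)%N then (minn m n)%:R
    else if [&& ~~ odd m, ~~ odd n & m + n == 6 %[mod 8]]%N
         then (m%:R + n%:R - 2) / 4 + 1
    else if [&& odd m, odd n & m + n == 2 %[mod 8]]%N
         then (m%:R + n%:R - 2) / 4 + 1
    else (m%:R + n%:R - 2) / 4)
   <= (queen_beta m n)%:R :> rat)%R.
Proof.
split.
  rewrite /queen_gamma; case: ex_minnP => k /existsP[D /andP[domD /eqP<-]] _.
  rewrite /queen_beta; case: ex_minnP => p _.
  by apply; exact: dominating_relaxed_cover.
rewrite /queen_beta; case: ex_minnP => p cov _.
have bound := relaxed_cover_bound cov.
(* The rational inequalities are integral once multiplied by 4. *)
have scale (k l : nat) : m + n + k <= 4 * p + l ->
  ((m%:R + n%:R + k%:R : rat) <= 4 * p%:R + l%:R)%R.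
  by move=> le; rewrite -GRing.natrM -!GRing.natrD Num.Theory.ler_nat.
case: ifPn => [long|short]; first by rewrite Num.Theory.ler_nat; lia.
case: ifPn => [/and3P[even_m even_n /eqP mod8]|not_even].
  have /scale : m + n + 2 <= 4 * p + 0 by lia.
  lra.
case: ifPn => [/and3P[odd_m odd_n /eqP mod8]|not_odd].
  have /scale : m + n + 2 <= 4 * p + 0 by lia.
  lra.
have /scale : m + n + 0 <= 4 * p + 2 by lia.
lra.
Qed.
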